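(* Let $X$ be a pointed metric space and $E$ a Banach space over $\mathbb{K}$. Then $\langle X\boxtimes E,\mathrm{Lip}_0(X,E^* )\rangle$ forms a dual pair, where the bilinear form $\langle\cdot,\cdot\rangle$ associated to the dual pair is given, for $u=\sum_{i=1}^n \delta_{(x_i,y_i)}\boxtimes e_i\in X\boxtimes E$ and $f\in\mathrm{Lip}_0(X,E^* )$, by $$\langle u,f\rangle=\sum_{i=1}^n \langle f(x_i)-f(y_i),e_i\rangle .$$ That is, this formula gives a well-defined bilinear form $(X\boxtimes E)\times \mathrm{Lip}_0(X,E^* )\to\mathbb{K}$, and $\mathrm{Lip}_0(X,E^* )$ separates the points of $X\boxtimes E$, and $X\boxtimes E$ separates the points of $\mathrm{Lip}_0(X,E^* )$.
   Context: $\mathbb{K}$ is $\mathbb{R}$ or $\mathbb{C}$. A pointed metric space $X$ is a metric space with a distinguished base point $0$. For a pointed metric space $X$ and a Banach space $F$, $\mathrm{Lip}_0(X,F)$ is the vector space of all Lipschitz maps $f\colon X\to F$ with $f(0)=0$. $E^*$ is the topological dual of $E$ and $\langle\phi,e\rangle=\phi(e)$; $V'$ denotes the algebraic dual of a vector space $V$. For $x,y\in X$ and $e\in E$, $\delta_{(x,y)}\boxtimes e\in \mathrm{Lip}_0(X,E^* )'$ is the linear functional $f\mapsto\langle f(x)-f(y),e\rangle$. The Lipschitz tensor product $X\boxtimes E$ is the linear subspace of $\mathrm{Lip}_0(X,E^* )'$ spanned by all the functionals $\delta_{(x,y)}\boxtimes e$ with $x,y\in X$, $e\in E$. Every $u\in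 X\boxtimes E$ can be written (non-uniquely) as $u=\sum_{i=1}^n\delta_{(x_i,y_i)}\boxtimes e_i$. *)

(* Defs.v *)
From HB Require Import structures.
From mathcomp Require Import all_boot all_order all_algebra.
From mathcomp Require Import all_classical all_reals.
From mathcomp Require Import topology normedtype.
From mathcomp Require Import complex.

Set Implicit Arguments.
Unset Strict Implicit.
Unset Printing Implicit Defensive.

Import Order.TTheory GRing.Theory Num.Theory.
Import numFieldNormedType.Exports.

Local Open Scope classical_set_scope.
Local Open Scope ring_scope.

Variant scalar_kind := RealScalars | ComplexScalars.

Definition scalars (R : realType) (k : scalar_kind) : numFieldType :=
  match k with RealScalars => R | ComplexScalars => R[i] end.

(* In MathComp-Analysis the norm of a normed module over K takes its values in
   K itself. The next two maps translate between R and the nonnegative real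
   elements of K, so that suprema and metrics can be taken in R. *)
Definition scalar_of_real (R : realType) (k : scalar_kind) :
    R -> scalars R k :=
  match k return R -> scalars R k with
  | RealScalars => fun r => r
  | ComplexScalars => fun r => (r%:C)%C
  end.

Definition scalar_abs (R : realType) (k : scalar_kind) : scalars R k -> R :=
  match k return scalars R k -> R with
  | RealScalars => fun z : R => `|z|
  | ComplexScalars => fun z : R[i] => complex.Re `|z|
  end.

Section ScalarLemmas.
Variables (R : realType) (k : scalar_kind).
Let K := scalars R k.
Local Notation ofR := (@scalar_of_real R k).
Local Notation abs := (@scalar_abs R k).

Lemma ofR_le (a b : R) : (ofR a <= ofR b) = (a <= b).
Proof. by rewrite /scalar_of_real; case: k => //=; rewrite lecR. Qed.

Lemma ofR0 : ofR 0 = 0.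
Proof. by rewrite /scalar_of_real; case: k. Qed.

Lemma ofRD (a b : R) : ofR (a + b) = ofR a + ofR b.
Proof. by rewrite /scalar_of_real; case: k => //=; rewrite rmorphD. Qed.

Lemma ofRM (a b : R) : ofR (a * b) = ofR a * ofR b.
Proof. by rewrite /scalar_of_real; case: k => //=; rewrite rmorphM. Qed.

Lemma ofR_abs (z : K) : ofR (abs z) = `|z|.
Proof. by move: z; rewrite /K /scalar_of_real /scalar_abs; case: k. Qed.

Lemma ofR_inj : injective ofR.
Proof. by move=> a b ab; apply/eqP; rewrite eq_le -!ofR_le ab lexx. Qed.

Lemma ofR_ge0 (a : R) : (0 <= ofR a) = (0 <= a).
Proof. by rewrite -ofR0 ofR_le. Qed.

Lemma ger0_ofR (z : K) : 0 <= z -> z = ofR (abs z).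
Proof. by move=> z0; rewrite ofR_abs ger0_norm. Qed.

End ScalarLemmas.

Section TopologicalDual.
Variables (R : realType) (k : scalar_kind).
Let K := scalars R k.
Variable E : normedModType K.

Definition dual_pred : {pred E -> K^o} :=
  fun phi => `[< linear phi /\ continuous phi >].

Record top_dual := TopDual { dual_fun :> E -> K^o; _ : dual_fun \in dual_pred }.

HB.instance Definition _ := [isSub for dual_fun].
HB.instance Definition _ := [Choice of top_dual by <:].

Lemma dual_submod_closed : submod_closed dual_pred.
Proof.
split.
  apply/asboolP; split; first by move=> a u v; rewrite /= scaler0 addr0.
  exact: cst_continuous.
move=> a f g /asboolP[lf cf] /asboolP[lg cg]; apply/asboolP; split.
  move=> b u v; rewrite !fctE lf lg !scalerDr !scalerA (mulrC b a).
  by rewrite addrACA.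
by move=> x; apply: cvgD; [apply: cvgZl_tmp; exact: cf|exact: cg].
Qed.

HB.instance Definition _ :=
  GRing.isSubmodClosed.Build K (E -> K^o) dual_pred dual_submod_closed.
HB.instance Definition _ := [SubChoice_isSubLmodule of top_dual by <:].

Lemma dual_is_linear (phi : top_dual) : linear phi.
Proof. by case: phi => f /= /asboolP[]. Qed.

Lemma dual_continuous (phi : top_dual) : continuous phi.
Proof. by case: phi => f /= /asboolP[]. Qed.

HB.instance Definition _ (phi : top_dual) :=
  GRing.isLinear.Build K E K^o *:%R phi (dual_is_linear phi).

Definition opnorm (phi : top_dual) : R :=
  sup [set scalar_abs (phi e : K) | e in [set e : E | `|e| <= 1]].

Let opnorm_has_sup (phi : top_dual) :
  has_sup [set scalar_abs (phi e : K) | e in [set e : E | `|e| <= 1]].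
Proof.
split; first by exists (scalar_abs (phi 0 : K)), 0 => //=; rewrite normr0.
have /linear_boundedP/pinfty_ex_gt0[M M0 HM] : bounded_near phi (nbhs (0 : E)).
  by apply/linear_bounded_continuous; exact: dual_continuous.
exists (scalar_abs M) => _ [e /= e1 <-].
rewrite -(@ofR_le R k) ofR_abs (le_trans (HM e))// ofR_abs gtr0_norm//.
by rewrite ler_piMr// ltW.
Qed.

Let abs_le_opnorm (phi : top_dual) (e : E) : `|e| <= 1 ->
  `|phi e : K^o| <= scalar_of_real k (opnorm phi).
Proof.
move=> e1; rewrite -[leLHS](@ofR_abs R k) ofR_le.
by apply: ub_le_sup; [exact: (opnorm_has_sup phi).2|exists e].
Qed.

Let opnorm_le (phi : top_dual) (r : K) : 0 <= r ->
  (forall e : E, `|e| <= 1 -> `|phi e : K^o| <= r) ->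
  scalar_of_real k (opnorm phi) <= r.
Proof.
move=> r0 H; rewrite (ger0_ofR r0) ofR_le.
apply: ge_sup; first exact: (opnorm_has_sup phi).1.
by move=> _ [e /= e1 <-]; rewrite -(@ofR_le R k) ofR_abs -ger0_ofR// H.
Qed.

Definition dual_norm (phi : top_dual) : K := scalar_of_real k (opnorm phi).

Let dual_norm_ge0 (phi : top_dual) : 0 <= dual_norm phi.
Proof. by apply: le_trans (abs_le_opnorm phi (e := 0) _); rewrite ?normr0. Qed.

Lemma dual_normD (phi psi : top_dual) :
  dual_norm (phi + psi) <= dual_norm phi + dual_norm psi.
Proof.
apply: opnorm_le => [|e e1]; first by rewrite addr_ge0.
by rewrite (le_trans (ler_normD _ _))// lerD// abs_le_opnorm.
Qed.

Lemma dual_normZ (a : K) (phi : top_dual) : dual_norm (a *: phi) = `|a| * dual_norm phi.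
Proof.
have H b psi : dual_norm (b *: psi) <= `|b| * dual_norm psi.
  apply: opnorm_le => [|e e1]; first by rewrite mulr_ge0.
  by rewrite normrZ ler_wpM2l// abs_le_opnorm.
apply/eqP; rewrite eq_le H/=; have [->|a0] := eqVneq a 0.
  by rewrite normr0 mul0r.
rewrite -ler_pdivlMl ?normr_gt0// -normfV.
by rewrite -{1}[phi](scalerK a0).
Qed.

Lemma dual_norm_eq0 (phi : top_dual) : dual_norm phi = 0 -> phi = 0.
Proof.
move=> phi0; apply: val_inj; apply/funext => e /=.
have H (u : E) : `|u| <= 1 -> phi u = 0.
  by move/(abs_le_opnorm phi); rewrite -/(dual_norm phi) phi0 normr_le0 => /eqP.
have [->|e0] := eqVneq e 0; first by rewrite linear0.
have ne0 : `|e| != 0 by rewrite normr_eq0.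
rewrite -[e](scalerKV ne0) linearZ/= H ?scaler0//.
by rewrite normrZ normfV normr_id mulVf.
Qed.

HB.instance Definition _ := Lmodule_isNormed.Build K top_dual
  dual_normD dual_normZ dual_norm_eq0.

End TopologicalDual.

Section Lip0.
Variables (R : realType) (k : scalar_kind) (X : metricType R) (x0 : X).
Let K := scalars R k.
Variable F : normedModType K.

Definition lipschitz_map (f : X -> F) :=
  exists L : R, forall x y,
    `|f x - f y| <= scalar_of_real k (L * mdist x y).

Definition lip0_pred : {pred X -> F} :=
  fun f => `[< lipschitz_map f /\ f x0 = 0 >].

Record lip0 := Lip0 { lip0_fun :> X -> F; _ : lip0_fun \in lip0_pred }.

HB.instance Definition _ := [isSub for lip0_fun].
HB.instance Definition _ := [Choice of lip0 by <:].

Lemma lip0_submod_closed : submod_closed lip0_pred.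
Proof.
split.
  by apply/asboolP; split=> //; exists 0 => x y; rewrite mul0r ofR0 subrr normr0.
move=> a f g /asboolP[[Lf Hf] f0] /asboolP[[Lg Hg] g0]; apply/asboolP; split.
  exists (scalar_abs a * Lf + Lg) => x y; rewrite !fctE opprD addrACA -scalerBr.
  rewrite (le_trans (ler_normD _ _))// normrZ mulrDl ofRD lerD//.
  by rewrite -mulrA ofRM ofR_abs ler_wpM2l.
by rewrite !fctE f0 g0 scaler0 addr0.
Qed.

HB.instance Definition _ :=
  GRing.isSubmodClosed.Build K (X -> F) lip0_pred lip0_submod_closed.
HB.instance Definition _ := [SubChoice_isSubLmodule of lip0 by <:].

End Lip0.

Section AlgebraicDual.
Variables (K : fieldType) (V : lmodType K).

Definition algdual_pred : {pred V -> K^o} := fun phi => `[< linear phi >].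

Record algdual :=
  AlgDual { algdual_fun :> V -> K^o; _ : algdual_fun \in algdual_pred }.

HB.instance Definition _ := [isSub for algdual_fun].
HB.instance Definition _ := [Choice of algdual by <:].

Lemma algdual_submod_closed : submod_closed algdual_pred.
Proof.
split; first by apply/asboolP => a u v; rewrite /= scaler0 addr0.
move=> a f g /asboolP lf /asboolP lg; apply/asboolP => b u v.
by rewrite !fctE lf lg !scalerDr !scalerA (mulrC b a) addrACA.
Qed.

HB.instance Definition _ :=
  GRing.isSubmodClosed.Build K (V -> K^o) algdual_pred algdual_submod_closed.
HB.instance Definition _ := [SubChoice_isSubLmodule of algdual by <:].

End AlgebraicDual.

Section LinearSpan.
Variables (K : fieldType) (V : lmodType K).

Definition linear_span (S : set V) : {pred V} := fun v =>
  `[< exists n (a : 'I_n -> K) (s : 'I_n -> V),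
        (forall i, S (s i)) /\ v = \sum_(i < n) a i *: s i >].

Lemma linear_span_submod_closed S : submod_closed (linear_span S).
Proof.
split.
  apply/asboolP; exists 0%N, (fun=> 0), (fun=> 0).
  by rewrite big_ord0; split=> // -[].
move=> c u v /asboolP[n [a [s [Ss ->]]]] /asboolP[m [b [t [St ->]]]].
apply/asboolP; exists (n + m)%N,
  (fun i => match fintype.split i with inl j => c * a j | inr j => b j end),
  (fun i => match fintype.split i with inl j => s j | inr j => t j end).
split=> [i|]; first by case: fintype.split.
rewrite big_split_ord/= scaler_sumr; congr (_ + _); apply: eq_bigr => i _.
  by rewrite (unsplitK (inl i)) scalerA.
by rewrite (unsplitK (inr i)).
Qed.

HB.instance Definition _ S := GRing.isSubmodClosed.Build K V
  (linear_span S) (linear_span_submod_closed S).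

End LinearSpan.

Section LipschitzTensorProduct.
Variables (R : realType) (k : scalar_kind) (X : metricType R) (x0 : X).
Let K := scalars R k.
Variable E : normedModType K.

Local Notation Lip0E := (lip0 x0 (top_dual E)).

Lemma delta_box_subproof (x y : X) (e : E) :
  (fun f : Lip0E => (f x - f y) e : K^o) \in @algdual_pred K Lip0E.
Proof.
apply/asboolP => a f g /=.
by rewrite opprD addrACA -scalerBr.
Qed.

Definition delta_box (x y : X) (e : E) : algdual Lip0E :=
  AlgDual (delta_box_subproof x y e).

Definition delta_boxes : set (algdual Lip0E) :=
  [set phi | exists x y e, phi = delta_box x y e].

Record lip_tensor := LipTensor {
  lip_tensor_val :> algdual Lip0E;
  _ : lip_tensor_val \in linear_span delta_boxes }.

HB.instance Definition _ := [isSub for lip_tensor_val].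
HB.instance Definition _ := [Choice of lip_tensor by <:].
HB.instance Definition _ := [SubChoice_isSubLmodule of lip_tensor by <:].

Definition is_lip_pairing (B : lip_tensor -> Lip0E -> K^o) :=
  forall n (x y : 'I_n -> X) (e : 'I_n -> E) (u : lip_tensor) (f : Lip0E),
    lip_tensor_val u = \sum_(i < n) delta_box (x i) (y i) (e i) ->
    B u f = \sum_(i < n) (f (x i) - f (y i)) (e i).

End LipschitzTensorProduct.

Section DualPair.
Variables (K : fieldType) (U V : lmodType K).

Definition dual_pair (B : U -> V -> K^o) :=
  [/\ bilinear_for *:%R *:%R B,
      forall u u', u <> u' -> exists v, B u v <> B u' v
    & forall v v', v <> v' -> exists u, B u v <> B u v'].

End DualPair.

(* Main.v *)
Require Import Defs.
From mathcomp Require Import all_boot all_algebra.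
From mathcomp Require Import all_classical reals.
From mathcomp Require Import topology normedtype.

(** An element of the Lipschitz tensor product is itself a linear functional
    on the space of Lipschitz maps, so the pairing is simply evaluation
    [(u, f) |-> u f].  This makes the formula independent of the chosen
    representation of [u]: any representation equals the same functional, and
    evaluating it at [f] gives the displayed sum ([lip_tensor_eval_pairing]).
    Uniqueness holds because every [u] has some representation
    ([lip_tensor_representation]), so that the formula prescribes each value.
    Two distinct tensors are distinct functionals, hence differ at some [f].
    Conversely, [f] is recovered from its pairings with elementary tensors
    based at the base point: since [f x0 = 0], the functional
    [delta_box x0 x x0 e] takes the value [f x e] at [f]
    ([elementary_tensor_eval]). *)

Import GRing.Theory.
Local Open Scope ring_scope.

Section LipschitzTensorPairing.
Variables (R : realType) (k : scalar_kind) (X : metricType R) (x0 : X).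
Variable E : normedModType (scalars R k).
Implicit Types (u : lip_tensor x0 E) (f : lip0 x0 (top_dual E)).

Definition lip_tensor_eval u f : (scalars R k)^o := lip_tensor_val u f.

Lemma algdual_sumE (K : fieldType) (V : lmodType K) (n : nat)
    (F : 'I_n -> algdual V) (v : V) : (\sum_i F i) v = \sum_i F i v.
Proof. by apply: (big_morph (fun phi : algdual V => phi v)). Qed.

Lemma delta_boxZ (a : scalars R k) (x y : X) (e : E) :
  a *: delta_box x0 x y e = delta_box x0 x y (a *: e).
Proof.
apply: val_inj; apply/funext => f /=.
exact: esym (linearZ_LR (f x - f y) a e).
Qed.

(** The scalar coefficients of a linear combination are absorbed in the vectors
    of [E], which is why sums without coefficients already exhaust the span. *)
Lemma lip_tensor_representation u :
  exists n (x y : 'I_n -> X) (e : 'I_n -> E),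
    lip_tensor_val u = \sum_(i < n) delta_box x0 (x i) (y i) (e i).
Proof.
case: u => phi /= /asboolP[n [a [s [/choice[x /choice[y /choice[e se]]] ->]]]].
exists n, x, y, (fun i => a i *: e i).
by apply: eq_bigr => i _; rewrite se delta_boxZ.
Qed.

Lemma lip_tensor_eval_pairing : is_lip_pairing lip_tensor_eval.
Proof. by move=> n x y e u f uE; rewrite /lip_tensor_eval uE algdual_sumE. Qed.

Lemma lip_pairing_unique (B C : lip_tensor x0 E -> lip0 x0 (top_dual E) ->
    (scalars R k)^o) :
  is_lip_pairing B -> is_lip_pairing C -> B = C.
Proof.
move=> HB HC; apply/funext => u; apply/funext => f.
have [n [x [y [e uE]]]] := lip_tensor_representation u.
by rewrite (HB _ _ _ _ _ _ uE) (HC _ _ _ _ _ _ uE).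
Qed.

Lemma delta_box_in_span (x y : X) (e : E) :
  delta_box x0 x y e \in linear_span (@delta_boxes R k X x0 E).
Proof.
apply/asboolP; exists 1%N, (fun=> 1), (fun=> delta_box x0 x y e).
by split=> [_|]; [exists x, y, e|rewrite big_ord1 scale1r].
Qed.

Definition elementary_tensor (x y : X) (e : E) : lip_tensor x0 E :=
  LipTensor (delta_box_in_span x y e).

Lemma lip0_base f : f x0 = 0.
Proof. by case: f => f /= /asboolP[]. Qed.

Lemma elementary_tensor_eval (x : X) (e : E) f :
  lip_tensor_eval (elementary_tensor x x0 e) f = f x e.
Proof. by rewrite /lip_tensor_eval /= lip0_base subr0. Qed.

Lemma lip_tensor_eval_bilinear : bilinear_for *:%R *:%R lip_tensor_eval.
Proof.
split=> [f a u v //|u a f g].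
by rewrite /lip_tensor_eval; case: (lip_tensor_val u) => phi /= /asboolP; apply.
Qed.

Lemma lip_tensor_eval_dual_pair : dual_pair lip_tensor_eval.
Proof.
split; first exact: lip_tensor_eval_bilinear.
- move=> u v uv; apply/existsNP => eq_uv; apply: uv.
  by do 2! apply: val_inj; apply/funext => f; exact: eq_uv.
- move=> f g fg; apply/existsNP => eq_fg; apply: fg.
  apply: val_inj; apply/funext => x; apply: val_inj; apply/funext => e /=.
  by rewrite -!elementary_tensor_eval; exact: eq_fg.
Qed.

End LipschitzTensorPairing.

Theorem theorem1p8 (R : realType) (k : scalar_kind) (X : metricType R) (x0 : X)
    (E : completeNormedModType (scalars R k)) :
  exists B : lip_tensor x0 E -> lip0 x0 (top_dual E) -> (scalars R k)^o,
    unique (@is_lip_pairing R k X x0 E) B /\ dual_pair B.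
Proof.
exists (@lip_tensor_eval R k X x0 E); split.
  split; first exact: lip_tensor_eval_pairing.
  by move=> B; apply: lip_pairing_unique; exact: lip_tensor_eval_pairing.
exact: lip_tensor_eval_dual_pair.
Qed.
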